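(* Assume that $\hat G \to^p G$ as $T\to\infty$ for some positive definite symmetric random matrix $G$, and that $r_T^{-1}(\tilde\theta-\theta^* )=O_p(1)$. If $r_T^{-1}a_T=O_p(1)$, then $$r_T^{-1}(\hat\theta^{(q)}-\theta^* )=O_p(1).$$
   Context: Let $(\Omega,\mathcal F,P)$ be a probability space, $\mathsf p$ a positive integer, $0<q\le 1$, and $(r_T)_T$ a sequence of positive numbers tending to $0$ as $T\to\infty$. All limits are as $T\to\infty$. The parameter is $\theta\in\mathbb R^{\mathsf p}$ with true value $\theta^*=[\theta_1^*,\dots,\theta_{\mathsf p}^*]'$ (prime denotes transpose), ordered so that $\theta_1^*\neq0,\dots,\theta^*_{\mathsf p^0}\neq 0$ and $\theta^*_{\mathsf p^0+1}=\dots=\theta^*_{\mathsf p}=0$. For each $T$, $\tilde\theta=\tilde\theta_T$ is an $\mathbb R^{\mathsf p}$-valued random vector (initial estimator), $\hat G=\hat G_T$ is a $\mathsf p\times\mathsf p$ almost surely positive definite symmetric random matrix, and $\kappa_T^j$ ($1\le j\le\mathsf p$) are nonnegative random variables. Define $$Q_T^{(q)}(\theta)=(\theta-\tilde\theta)'\hat G(\theta-\tilde\theta)+\sum_{j=1}^{\mathsf p}\kappa_T^j|\theta_j|^q,$$ and let $\hat\theta^{(q)}$ (the penalized LSA estimator, depending on $T$) be a random vector minimizing $Q_T^{(q)}$ over $\mathbb R^{\mathsf p}$. Put $a_T=\max\{\kappa_T^j: j\le\mathsf p^0\}$ (with $\max\emptyset=0$). *)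

(* Defs.v *)
From HB Require Import structures.
From mathcomp Require Import all_boot all_order all_algebra.
From mathcomp Require Import all_classical all_reals all_analysis.

Set Implicit Arguments.
Unset Strict Implicit.
Unset Printing Implicit Defensive.

Import Order.TTheory GRing.Theory Num.Theory.
Import numFieldNormedType.Exports.

Local Open Scope classical_set_scope.
Local Open Scope ring_scope.

Definition random_matrix (R : realType) (d : measure_display)
    (Omega : measurableType d) (m n : nat) (X : Omega -> 'M[R]_(m, n)) : Prop :=
  forall i j, measurable_fun [set: Omega] (fun w => X w i j).

(* The norm of the library on matrices is the maximum norm; since all norms of
   a finite-dimensional space are equivalent, the next two notions do not
   depend on this choice. *)

(* X_t = O_p(1) along the filter F: tightness is only required eventually. *)
Definition bounded_in_probability (R : realType) (d : measure_display)
    (Omega : measurableType d) (P : probability Omega R) (I : Type)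
    (F : set_system I) (V : normedModType R) (X : I -> Omega -> V) : Prop :=
  forall e : R, 0 < e ->
    exists M : R, \forall t \near F, (P [set w | (M < `|X t w|)%R] <= e%:E)%E.

Definition cvg_in_probability (R : realType) (d : measure_display)
    (Omega : measurableType d) (P : probability Omega R) (I : Type)
    (F : set_system I) (V : normedModType R) (X : I -> Omega -> V)
    (Y : Omega -> V) : Prop :=
  forall e : R, 0 < e ->
    P [set w | e < `|X t w - Y w|] @[t --> F] --> 0%E.

Definition sym_posdef (R : realType) (n : nat) (A : 'M[R]_n) : Prop :=
  A \is symmetricmx /\ forall x : 'cV[R]_n, x != 0 -> 0 < (x^T *m A *m x) 0 0.

Definition penalized_LSA (R : realType) (p : nat) (q : R)
    (thetatilde : 'cV[R]_p) (Ghat : 'M[R]_p) (kappa : 'I_p -> R)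
    (theta : 'cV[R]_p) : R :=
  ((theta - thetatilde)^T *m Ghat *m (theta - thetatilde)) 0 0 +
  \sum_(j < p) kappa j * (`|theta j 0| `^ q).

(* With 0-based indices, j < p0 selects the first p0 coordinates. The initial
   value 0 is the value of the maximum over the empty set; it has no effect
   otherwise as soon as kappa is nonnegative. *)
Definition max_active_weight (R : realType) (p p0 : nat) (kappa : 'I_p -> R) : R :=
  \big[Num.max/0]_(j < p | (j < p0)%N) kappa j.

(* Main.v *)
(* Write u = thetahat - thetastar and v = thetatilde - thetastar, and compare
   the criterion at thetahat and at thetastar. For q <= 1 the map x |-> x^q
   satisfies x^q - y^q <= x^(q-1) |x - y| for all x > 0 and y >= 0, near to or
   far from x, so the penalty terms are bounded by C a_T |u| without knowing in
   advance that thetahat is consistent; the zero coordinates of thetastar only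
   contribute nonpositive terms. Hence
     (u - v)' Ghat (u - v) <= v' Ghat v + C a_T |u|.
   With high probability, G and its inverse are bounded and Ghat is close to G,
   so Ghat is uniformly elliptic, |v| = O(r_T) and a_T = O(r_T); this gives
   |u|^2 <= B r_T^2 + D r_T |u|, and therefore |u| = O(r_T). *)

Require Import Defs.
From HB Require Import structures.
From mathcomp Require Import all_boot all_order all_algebra.
From mathcomp Require Import all_classical all_reals all_analysis.
From mathcomp Require Import ring lra measurable_realfun.
Import Order.TTheory GRing.Theory Num.Theory.
Import numFieldNormedType.Exports.
Local Open Scope classical_set_scope.
Local Open Scope ring_scope.

(** * Quadratic forms and the maximum norm *)

Definition quad_form {R : realType} {n : nat} (A : 'M[R]_n) (x : 'cV[R]_n) : R :=
  (x^T *m A *m x) 0 0.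

Lemma quad_formN {R : realType} {n : nat} (A : 'M[R]_n) (x : 'cV[R]_n) :
  quad_form A (- x) = quad_form A x.
Proof. by rewrite /quad_form [(- x)^T]linearN/= mulmxN !mulNmx opprK. Qed.

Lemma mx_entry_le_norm {R : realType} {m n : nat} (A : 'M[R]_(m, n)) i j :
  `|A i j| <= `|A|.
Proof.
rewrite [leRHS]/Num.norm/= mx_normrE.
exact: (le_bigmax 0 (fun ij => `|A ij.1 ij.2|) (i, j)).
Qed.

Lemma sqr_mx_norm_le {R : realType} {m n : nat} (A : 'M[R]_(m, n)) (c : R) :
  0 <= c -> (forall i j, A i j ^+ 2 <= c) -> `|A| ^+ 2 <= c.
Proof.
move=> c_ge0 Ac; rewrite [X in X ^+ 2]/Num.norm/=.
have [->|/mx_norm_neq0[[i j] ->]/=] := eqVneq (mx_norm A) 0.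
  by rewrite expr0n.
by rewrite real_normK ?num_real.
Qed.

Lemma quad_formE {R : realType} {n : nat} (A : 'M[R]_n) (x : 'cV[R]_n) :
  quad_form A x = \sum_j \sum_i x i 0 * A i j * x j 0.
Proof.
rewrite /quad_form mxE; apply: eq_bigr => j _.
by rewrite mxE mulr_suml; apply: eq_bigr => i _; rewrite mxE.
Qed.

Lemma quad_form_le {R : realType} {n : nat} (A : 'M[R]_n) (x : 'cV[R]_n) :
  `|quad_form A x| <= n%:R ^+ 2 * `|A| * `|x| ^+ 2.
Proof.
have -> : n%:R ^+ 2 * `|A| * `|x| ^+ 2 =
    \sum_(j < n) \sum_(i < n) `|x| * `|A| * `|x|.
  by rewrite !sumr_const card_ord -mulrnA -[RHS]mulr_natr natrM; ring.
rewrite quad_formE; apply: le_trans (ler_norm_sum _ _ _) _.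
apply: ler_sum => j _; apply: le_trans (ler_norm_sum _ _ _) _.
by apply: ler_sum => i _; rewrite !normrM !ler_pM ?mulr_ge0// mx_entry_le_norm.
Qed.

(** A nonzero row of the left kernel, once transposed, would be a nonzero vector at which the
    quadratic form vanishes. *)
Lemma sym_posdef_unitmx {R : realType} {n : nat} (A : 'M[R]_n) :
  sym_posdef A -> A \in unitmx.
Proof.
move=> [_ A_gt0]; rewrite -row_free_unit -kermx_eq0.
apply/eqP/row_matrixP => i; rewrite row0; apply/eqP.
apply/negPn/negP => x_neq0; have := A_gt0 (row i (kermx A))^T.
by rewrite trmx_eq0 trmxK -row_mul mulmx_ker row0 mul0mx mxE ltxx => /(_ x_neq0).
Qed.

(* Cauchy-Schwarz for the scalar product of A, applied to x and to the i-th
   column of the inverse of A. *)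
Lemma sqr_entry_le_quad_form {R : realType} {n : nat} (A : 'M[R]_n)
    (x : 'cV[R]_n) (i : 'I_n) :
  sym_posdef A -> x i 0 ^+ 2 <= invmx A i i * quad_form A x.
Proof.
move=> A_pos; have A_unit := sym_posdef_unitmx A A_pos; case: A_pos => A_sym A_gt0.
have A_tr : A^T = A.
  apply/matrixP => k l; rewrite mxE.
  by move/is_hermitianmxP : A_sym => /matrixP/(_ k l); rewrite !mxE expr0 mul1r => ->.
pose y := col i (invmx A).
have Ay : A *m y = delta_mx i 0 by rewrite /y colE mulmxA mulmxV// mul1mx.
have yA : y^T *m A = delta_mx 0 i by rewrite -[A in LHS]A_tr -trmx_mul Ay trmx_delta.
have yAy : quad_form A y = invmx A i i.
  by rewrite /quad_form yA -rowE !mxE.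
(* [y] is nonzero because [A *m y] is a basis vector. *)
have i_gt0 : 0 < invmx A i i.
  rewrite -yAy; apply: A_gt0; apply/negP => /eqP y0.
  have := Ay; rewrite y0 mulmx0 => /matrixP/(_ i 0).
  by rewrite !mxE !eqxx => /eqP; rewrite eq_sym oner_eq0.
have qf t : quad_form A (x - t *: y) =
    quad_form A x - 2 * t * x i 0 + t ^+ 2 * invmx A i i.
  rewrite -yAy /quad_form [(x - _)^T]linearB/= [(t *: y)^T]linearZ/= !mulmxBl !mulmxBr.
  rewrite -!scalemxAl -!scalemxAr yA -(mulmxA _ A y) Ay -[delta_mx 0 i *m x]rowE.
  rewrite -[delta_mx 0 i *m y]rowE -[x^T *m _]colE !mxE; ring.
(* This [t] minimizes the polynomial in [qf]; nonnegativity of the form at the minimum is the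
   claim. *)
set t := x i 0 / invmx A i i.
have : 0 <= quad_form A (x - t *: y).
  have [->|/A_gt0/ltW//] := eqVneq (x - t *: y) 0.
  by rewrite /quad_form mulmx0 mxE.
have xE : x i 0 = t * invmx A i i by rewrite mulfVK// gt_eqF.
rewrite qf xE => qf_ge0.
have := mulr_ge0 (ltW i_gt0) qf_ge0; nra.
Qed.

(** [L] bounds the diagonal of [invmx A], so [|x|^2] is at most [L] times the form of [A]. Passing
    from [A] to [B] costs at most half of [|x|^2], which is absorbed on the left and produces the
    factor 2. *)
Lemma sqr_norm_le_quad_form {R : realType} {n : nat} (A B : 'M[R]_n) (L : R)
    (x : 'cV[R]_n) :
  sym_posdef A -> `|invmx A| <= L -> L * n%:R ^+ 2 * `|B - A| <= 2^-1 ->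
  `|x| ^+ 2 <= 2 * L * quad_form B x.
Proof.
move=> A_pos AL BA.
have L_ge0 : 0 <= L by rewrite (le_trans _ AL).
have xA_ge0 : 0 <= quad_form A x.
  have [->|/A_pos.2/ltW//] := eqVneq x 0.
  by rewrite /quad_form mulmx0 mxE.
have xA : `|x| ^+ 2 <= L * quad_form A x.
  apply: sqr_mx_norm_le => [|i j]; first exact: mulr_ge0.
  rewrite (ord1 j) (le_trans (sqr_entry_le_quad_form A x i A_pos))//.
  rewrite ler_wpM2r// (le_trans _ AL)// (le_trans (ler_norm _))//.
  exact: mx_entry_le_norm.
have xB : quad_form A x = quad_form B x - quad_form (B - A) x.
  by rewrite /quad_form mulmxBr mulmxBl !mxE; ring.
have /ler_normlP[xBA _] := quad_form_le (B - A) x.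
have := ler_wpM2l L_ge0 xBA.
have := ler_wpM2r (sqr_ge0 `|x|) BA.
move: xA; rewrite xB; lra.
Qed.

(** * The penalty and the deterministic bound *)

(** For [0 < y < x] the ratio [s = y / x] satisfies [s <= s^q], hence
    [x^q (1 - s^q) <= x^q (1 - s)]. When [x = 0] the right side is 0 and the left side is
    nonpositive. *)
Lemma powR_sub_le {R : realType} (q x y : R) :
  0 < q -> q <= 1 -> 0 <= x -> 0 <= y ->
  x `^ q - y `^ q <= x `^ q / x * `|x - y|.
Proof.
move=> q_gt0 q_le1; rewrite le_eqVlt => /predU1P[<-|x_gt0] y_ge0.
  by rewrite powR0 ?gt_eqF// mul0r mul0r sub0r oppr_le0 powR_ge0.
have [xy|yx] := leP x y.
  rewrite (@le_trans _ _ 0)//; last by rewrite !mulr_ge0 ?invr_ge0 ?powR_ge0 ?(ltW x_gt0).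
  by rewrite subr_le0 ge0_ler_powR ?nnegrE// ltW.
have x_neq0 : x != 0 by rewrite gt_eqF.
have -> : x `^ q / x * `|x - y| = x `^ q - x `^ q * (y / x).
  by rewrite gtr0_norm ?subr_gt0//; field.
rewrite lerB//.
have [->|y_neq0] := eqVneq y 0; first by rewrite mul0r mulr0 powR_ge0.
have y_gt0 : 0 < y by rewrite lt_neqAle eq_sym y_neq0.
have {2}-> : y = x * (y / x) by field.
rewrite powRM ?divr_ge0 ?(ltW x_gt0)// ler_wpM2l ?powR_ge0// ger1_powR//.
by rewrite divr_gt0//= ler_pdivrMr// mul1r ltW.
Qed.

(** Only the support of [x] needs the weight bound [a]: elsewhere the left summand is nonpositive
    and the right one is 0, since [0^q = 0]. *)
Lemma sum_powR_sub_le {R : realType} (p : nat) (q a : R) (k : 'I_p -> R)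
    (x y : 'cV[R]_p) :
  0 < q -> q <= 1 -> 0 <= a -> (forall j, 0 <= k j) ->
  (forall j, x j 0 != 0 -> k j <= a) ->
  \sum_j k j * `|x j 0| `^ q - \sum_j k j * `|y j 0| `^ q <=
  (\sum_j `|x j 0| `^ q / `|x j 0|) * a * `|y - x|.
Proof.
move=> q_gt0 q_le1 a_ge0 k_ge0 ka; rewrite -sumrB !mulr_suml.
apply: ler_sum => j _; rewrite -mulrBr.
have c_ge0 : 0 <= `|x j 0| `^ q / `|x j 0| by rewrite divr_ge0 ?powR_ge0.
have [x0|x_neq0] := eqVneq (x j 0) 0.
  rewrite x0 normr0 powR0 ?gt_eqF// mul0r !mul0r sub0r mulrN oppr_le0.
  by rewrite mulr_ge0 ?powR_ge0.
set z := `|y - x|; set c := `|x j 0| `^ q / `|x j 0|.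
apply: (@le_trans _ _ (k j * (c * z))).
  rewrite ler_wpM2l//; apply: le_trans (powR_sub_le q _ _ q_gt0 q_le1 _ _) _ => //.
  rewrite ler_wpM2l// (le_trans (ler_dist_dist _ _))// distrC.
  by have := mx_entry_le_norm (y - x) j 0; rewrite !mxE.
by rewrite mulrCA -mulrA; apply: ler_wpM2l => //; rewrite ler_wpM2r ?ka ?normr_ge0.
Qed.

(** If the bound failed, then [s > r], thanks to the summand 1, so
    [B r^2 + D r s <= (B + D) r s < s^2]. *)
Lemma quadratic_bound {R : realType} (B D r s : R) :
  0 <= B -> 0 <= D -> 0 < r -> s ^+ 2 <= B * r ^+ 2 + D * r * s ->
  s <= (B + D + 1) * r.
Proof.
move=> B_ge0 D_ge0 r_gt0 s_le; rewrite leNgt; apply/negP => s_gt.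
have rs : r < s by apply: le_lt_trans s_gt; nra.
have Br : 0 <= B * r by rewrite mulr_ge0// ltW.
nra.
Qed.

(** [K] is chosen before the rate, the matrices and the weights, so one constant serves all indices
    and all outcomes. *)
Lemma penalized_LSA_minimizer_bound {R : realType} (p p0 : nat) (q : R)
    (L L' M M' : R) (thetastar : 'cV[R]_p) :
  0 < q -> q <= 1 -> 0 <= L -> 0 <= L' ->
  (forall j : 'I_p, (p0 <= j)%N -> thetastar j 0 = 0) ->
  exists K : R, forall (r : R) (A B : 'M[R]_p) (tt th : 'cV[R]_p) (k : 'I_p -> R),
    0 < r -> (forall j, 0 <= k j) ->
    sym_posdef A -> `|invmx A| <= L -> L * p%:R ^+ 2 * `|B - A| <= 2^-1 ->
    `|B| <= L' -> `|tt - thetastar| <= M * r -> max_active_weight p0 k <= M' * r ->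
    penalized_LSA q tt B k th <= penalized_LSA q tt B k thetastar ->
    `|th - thetastar| <= K * r.
Proof.
move=> q_gt0 q_le1 L_ge0 L'_ge0 thetastar0.
set C := \sum_j `|thetastar j 0| `^ q / `|thetastar j 0|.
have C_ge0 : 0 <= C by apply: sumr_ge0 => j _; rewrite divr_ge0 ?powR_ge0.
(* [b] and [D] come from [|u|^2 <= 2 |u - v|^2 + 2 |v|^2], with [|u - v|^2] at most [2 L] times the
   form of [B] at [u - v]. *)
set b := 4 * L * p%:R ^+ 2 * L' * M ^+ 2 + 2 * M ^+ 2.
set D := 4 * L * C * M'.
exists (b + D + 1) => r A B tt th k r_gt0 k_ge0 A_pos AL BA BL' tt_le a_le th_min.
have b_ge0 : 0 <= b.
  have := mulr_ge0 (mulr_ge0 L_ge0 (sqr_ge0 p%:R)) (mulr_ge0 L'_ge0 (sqr_ge0 M)).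
  by have := sqr_ge0 M; rewrite /b; lra.
set a := max_active_weight p0 k in a_le.
have a_ge0 : 0 <= a by apply/bigmax_geP; left.
have M'_ge0 : 0 <= M' by rewrite -(pmulr_lge0 _ r_gt0) (le_trans a_ge0).
have D_ge0 : 0 <= D by rewrite !mulr_ge0 ?ler0n.
apply: quadratic_bound => //.
have ka j : thetastar j 0 != 0 -> k j <= a.
  move=> j_neq0; apply: le_bigmax_cond; rewrite ltnNge; apply: contra j_neq0.
  by move=> /thetastar0 ->.
have pen := sum_powR_sub_le p q a k thetastar th q_gt0 q_le1 a_ge0 k_ge0 ka.
set u := th - thetastar in pen *; set v := tt - thetastar in tt_le.
have uv : th - tt = u - v by rewrite /u /v opprB addrA subrK.
have vN : thetastar - tt = - v by rewrite opprB.
move: th_min; rewrite /penalized_LSA -/(quad_form B _) -/(quad_form B _).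
rewrite uv vN quad_formN -/C in pen * => th_min.
have uv_le := sqr_norm_le_quad_form A B L (u - v) A_pos AL BA.
have /ler_normlP[_ v_le] := quad_form_le B v.
have vM : `|v| ^+ 2 <= M ^+ 2 * r ^+ 2 by rewrite -exprMn ler_sqr ?nnegrE// (le_trans _ tt_le).
have Bv : quad_form B v <= p%:R ^+ 2 * L' * (M ^+ 2 * r ^+ 2).
  apply: le_trans v_le _; apply: ler_pM => //.
  by rewrite ler_wpM2l// sqr_ge0.
have Cau : C * a * `|u| <= C * (M' * r) * `|u| by rewrite ler_wpM2r// ler_wpM2l.
have u_le : `|u| ^+ 2 <= 2 * `|u - v| ^+ 2 + 2 * `|v| ^+ 2.
  have : `|u| <= `|u - v| + `|v| by rewrite -{1}(subrK v u) ler_normD.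
  have := normr_ge0 u; have := sqr_ge0 (`|u - v| - `|v|); nra.
have : quad_form B (u - v) <= p%:R ^+ 2 * L' * (M ^+ 2 * r ^+ 2) + C * (M' * r) * `|u|.
  lra.
move=> /(ler_wpM2l L_ge0); rewrite /b /D; lra.
Qed.

(** * Measurability of inverses, norms and determinants *)

(** Writing [1/f] as [f] times the power -1 of [f^2] keeps the base of the power nonnegative; the
    factor [f] gives 0 where [f] vanishes. *)
Lemma measurable_funV {R : realType} {d : measure_display}
    {T : measurableType d} (f : T -> R) :
  measurable_fun [set: T] f -> measurable_fun [set: T] (fun w => (f w)^-1).
Proof.
move=> mf; have -> : (fun w => (f w)^-1) = (fun w => f w * (f w ^+ 2) `^ (-1)).
  apply/funext => w; rewrite powR_inv1 ?sqr_ge0//.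
  have [->|fw_neq0] := eqVneq (f w) 0; first by rewrite mul0r invr0.
  by field.
apply: measurable_funM => //.
have := measurableT_comp (measurable_powR (-1)) (measurable_funX 2 mf).
exact.
Qed.

Lemma measurable_bigmaxr {R : realType} {d : measure_display}
    {T : measurableType d} {I : Type} (s : seq I) (Q : pred I) (f : I -> T -> R) :
  (forall i, measurable_fun [set: T] (f i)) ->
  measurable_fun [set: T] (fun w => \big[Num.max/0]_(i <- s | Q i) f i w).
Proof.
move=> mf; elim: s => [|i s ih].
  by under eq_fun do rewrite big_nil; exact: measurable_cst.
under eq_fun do rewrite big_cons; case: (Q i) => //.
exact: measurable_maxr.
Qed.

Lemma measurable_mx_norm {R : realType} {d : measure_display}
    {T : measurableType d} {m n : nat} (X : T -> 'M[R]_(m, n)) :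
  random_matrix X -> measurable_fun [set: T] (fun w => `|X w|).
Proof.
move=> mX; under eq_fun do rewrite [`|_|]/Num.norm/= mx_normrE.
apply: measurable_bigmaxr => ij.
exact: (measurableT_comp (@normr_measurable R setT)).
Qed.

Lemma random_matrixB {R : realType} {d : measure_display}
    {T : measurableType d} {m n : nat} (X Y : T -> 'M[R]_(m, n)) :
  random_matrix X -> random_matrix Y -> random_matrix (fun w => X w - Y w).
Proof.
by move=> mX mY i j; under eq_fun do rewrite !mxE; exact: measurable_funB.
Qed.

Lemma random_matrixZ {R : realType} {d : measure_display}
    {T : measurableType d} {m n : nat} (f : T -> R) (X : T -> 'M[R]_(m, n)) :
  measurable_fun [set: T] f -> random_matrix X ->
  random_matrix (fun w => f w *: X w).
Proof.
by move=> mf mX i j; under eq_fun do rewrite !mxE; exact: measurable_funM.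
Qed.

Lemma measurable_det {R : realType} {d : measure_display}
    {T : measurableType d} {n : nat} (X : T -> 'M[R]_n) :
  random_matrix X -> measurable_fun [set: T] (fun w => \det (X w)).
Proof.
move=> mX; apply: measurable_sum => s; apply: measurable_funM => //.
by apply: measurable_prod => i _.
Qed.

Lemma random_matrix_adj {R : realType} {d : measure_display}
    {T : measurableType d} {n : nat} (X : T -> 'M[R]_n) :
  random_matrix X -> random_matrix (fun w => \adj (X w)).
Proof.
move=> mX i j; under eq_fun do rewrite mxE /cofactor.
apply: measurable_funM => //; apply: measurable_det => k l.
by under eq_fun do rewrite !mxE; exact: mX.
Qed.

Lemma measurable_superlevel {R : realType} {d : measure_display}
    {T : measurableType d} (f : T -> R) (c : R) :
  measurable_fun [set: T] f -> measurable [set w | c < f w].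
Proof.
move=> mf; have := mf measurableT _ (measurable_itv `]c, +oo[).
by rewrite setTI preimage_itvoy.
Qed.

(** * Probability estimates and the theorem *)

Lemma near_cvge0_le {R : realType} {I : Type} (F : set_system I) {FF : Filter F}
    (f : I -> \bar R) (e : R) :
  0 < e -> f t @[t --> F] --> 0%E -> \forall t \near F, (f t <= e%:E)%E.
Proof.
move=> e_gt0 f0; have e_nbhs : nbhs (0%R%:E : \bar R) [set y | (y < e%:E)%E].
  by apply: open_nbhs_nbhs; split; [exact: open_ereal_lt_ereal | rewrite /= lte_fin].
have ft : \forall t \near F, (f t < e%:E)%E := f0 _ e_nbhs.
by apply: filterS ft => t /ltW.
Qed.

(** Continuity from above: the superlevel sets of a real-valued function decrease to the empty set.
    The thresholds [n.+1] make [M] positive. *)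
Lemma measurable_tight {R : realType} {d : measure_display}
    {T : measurableType d} (P : probability T R) (f : T -> R) (e : R) :
  measurable_fun [set: T] f -> 0 < e ->
  exists2 M : R, 0 < M & (P [set w | (M < f w)%R] <= e%:E)%E.
Proof.
move=> mf e_gt0; pose F (n : nat) := [set w | n.+1%:R < f w].
have F0 : \bigcap_n F n = set0.
  apply/seteqP; split => // w Fw.
  have := Fw (Num.truncn (f w)) I; rewrite /F/= ltNge => /negP; apply.
  exact/ltW/truncnS_gt.
have PF : P \o F @ \oo --> P (\bigcap_n F n).
  apply: nonincreasing_cvg_mu => [|n||m n mn].
  - exact: le_lt_trans (probability_le1 _ (measurable_superlevel _ _ mf)) (ltry _).
  - exact: measurable_superlevel.
  - by rewrite F0.
  - apply/subsetPset => w; rewrite /F/=; apply: le_lt_trans.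
    by rewrite ler_nat ltnS.
rewrite F0 measure0 in PF; have [n _ Pn] := near_cvge0_le _ _ e e_gt0 PF.
exists n.+1%:R => //; exact: (Pn n (leqnn n)).
Qed.

Lemma measureU_le {R : realType} {d : measure_display}
    {T : measurableType d} (P : {measure set T -> \bar R}) (A B : set T) (a b : R) :
  measurable A -> measurable B -> (P A <= a%:E)%E -> (P B <= b%:E)%E ->
  (P (A `|` B) <= (a + b)%:E)%E.
Proof.
by move=> mA mB Pa Pb; rewrite EFinD (le_trans (measureU2 _ mA mB))// leeD.
Qed.

(** The failures of the implication are covered by a measurable null set [N], so [A] lies in the
    union of [B] and [N]. *)
Lemma le_measure_ae {R : realType} {d : measure_display}
    {T : measurableType d} (P : {measure set T -> \bar R}) (A B : set T) :
  measurable A -> measurable B -> {ae P, forall w, A w -> B w} ->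
  (P A <= P B)%E.
Proof.
move=> mA mB [N [mN N0 AN]].
apply: (@le_trans _ _ (P (B `|` N))).
  apply: le_measure; rewrite ?inE//; first exact: measurableU.
  move=> w Aw; have [Bw|nBw] := pselect (B w); [by left|right].
  by apply: AN => /= /(_ Aw).
apply: le_trans (measureU2 _ mB mN) _.
by rewrite [X in (_ + X)%E](_ : _ = 0%E) ?adde0.
Qed.

(* TT is the set of the values taken by the index T; it is an arbitrary
   unbounded set of reals, so that both T = 1, 2, 3, ... and a continuous T
   are covered, and limits are taken as T tends to +oo inside TT. *)
Theorem theorem1 (R : realType) (d : measure_display) (Omega : measurableType d)
  (P : probability Omega R)
  (TT : set R) (TT_unbounded : forall A : R, exists2 T, TT T & A < T)
  (p : nat) (p_gt0 : (0 < p)%N)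
  (q : R) (q_gt0 : 0 < q) (q_le1 : q <= 1)
  (r : R -> R) (r_gt0 : forall T, TT T -> 0 < r T)
  (r_cvg0 : r T @[T --> within TT +oo] --> 0)
  (thetastar : 'cV[R]_p) (p0 : nat) (p0_le : (p0 <= p)%N)
  (thetastar_neq0 : forall j : 'I_p, (j < p0)%N -> thetastar j 0 != 0)
  (thetastar_eq0 : forall j : 'I_p, (p0 <= j)%N -> thetastar j 0 = 0)
  (thetatilde : R -> Omega -> 'cV[R]_p)
  (thetatilde_meas : forall T, TT T -> random_matrix (thetatilde T))
  (Ghat : R -> Omega -> 'M[R]_p)
  (Ghat_meas : forall T, TT T -> random_matrix (Ghat T))
  (Ghat_posdef : forall T, TT T -> {ae P, forall w, sym_posdef (Ghat T w)})
  (kappa : R -> 'I_p -> Omega -> R)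
  (kappa_meas : forall T j, TT T -> measurable_fun [set: Omega] (kappa T j))
  (kappa_ge0 : forall T j w, TT T -> 0 <= kappa T j w)
  (thetahat : R -> Omega -> 'cV[R]_p)
  (thetahat_meas : forall T, TT T -> random_matrix (thetahat T))
  (thetahat_min : forall T, TT T -> {ae P, forall w, forall theta : 'cV[R]_p,
     penalized_LSA q (thetatilde T w) (Ghat T w) (fun j => kappa T j w)
       (thetahat T w) <=
     penalized_LSA q (thetatilde T w) (Ghat T w) (fun j => kappa T j w) theta})
  (G : Omega -> 'M[R]_p)
  (G_meas : random_matrix G)
  (G_posdef : {ae P, forall w, sym_posdef (G w)})
  (Ghat_cvg : cvg_in_probability P (within TT +oo) Ghat G)
  (thetatilde_Op : bounded_in_probability P (within TT +oo)
     (fun T w => (r T)^-1 *: (thetatilde T w - thetastar)))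
  (a_Op : bounded_in_probability P (within TT +oo)
     (fun T w => (r T)^-1 * max_active_weight p0 (fun j => kappa T j w) : R^o)) :
  bounded_in_probability P (within TT +oo)
    (fun T w => (r T)^-1 *: (thetahat T w - thetastar)).
Proof.
(* One fifth for each bad event: [G] large, its inverse large, the initial estimator far off, the
   active weights large, [Ghat] far from [G]. *)
move=> e e_gt0; pose e5 := e / 5; have e5_gt0 : 0 < e5 by rewrite divr_gt0.
(* N is the inverse of G wherever G is invertible, without the case analysis
   of invmx, and so is clearly measurable. *)
pose N w := (\det (G w))^-1 *: \adj (G w).
have N_meas : random_matrix N.
  apply: random_matrixZ; last exact: random_matrix_adj.
  exact/measurable_funV/measurable_det.
have [K K_gt0 PK] := measurable_tight P _ e5 (measurable_mx_norm _ G_meas) e5_gt0.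
have [L L_gt0 PL] := measurable_tight P _ e5 (measurable_mx_norm _ N_meas) e5_gt0.
have [M PM] := thetatilde_Op e5 e5_gt0.
have [M' PM'] := a_Op e5 e5_gt0.
have p2_gt0 : 0 < p%:R ^+ 2 :> R by rewrite exprn_gt0// ltr0n.
(* Chosen so that [L * p^2 * delta = 1/2], the closeness required for ellipticity of [Ghat]; then
   [K + delta] bounds the norm of [Ghat]. *)
pose delta := (2 * (L * p%:R ^+ 2))^-1.
have delta_gt0 : 0 < delta by rewrite invr_gt0 pmulr_rgt0// mulr_gt0.
have PD : \forall T \near within TT +oo,
    (P [set w | (delta < `|Ghat T w - G w|)%R] <= e5%:E)%E.
  by apply: near_cvge0_le => //; exact: Ghat_cvg.
have L'_ge0 : 0 <= K + delta by rewrite addr_ge0 ?ltW.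
have [C bound] := penalized_LSA_minimizer_bound p p0 q L (K + delta) M M'
  thetastar q_gt0 q_le1 (ltW L_gt0) L'_ge0 thetastar_eq0.
exists C.
have TT_near : \forall T \near within TT +oo, TT T by exact: withinT.
near=> T.
have TTT : TT T by near: T.
have PMT : (P [set w | (M < `|(r T)^-1 *: (thetatilde T w - thetastar)|)%R] <= e5%:E)%E.
  by near: T.
have PM'T : (P [set w | (M' < `|(r T)^-1 *
    max_active_weight p0 (fun j => kappa T j w) : R^o|)%R] <= e5%:E)%E by near: T.
have PDT : (P [set w | (delta < `|Ghat T w - G w|)%R] <= e5%:E)%E by near: T.
have rT := r_gt0 T TTT.
set U := [set w | _].
set B1 := [set w | K < `|G w|] in PK.
set B2 := [set w | L < `|N w|] in PL.
set B3 := [set w | _] in PMT.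
set B4 := [set w | _] in PM'T.
set B5 := [set w | _] in PDT.
have cst_meas : random_matrix (fun _ : Omega => thetastar).
  by move=> i j; exact: measurable_cst.
have mU : measurable U.
  apply: measurable_superlevel; apply: measurable_mx_norm.
  by apply: random_matrixZ => //; apply: random_matrixB => //; exact: thetahat_meas.
have mB1 : measurable B1.
  by apply: measurable_superlevel; apply: measurable_mx_norm.
have mB2 : measurable B2.
  by apply: measurable_superlevel; apply: measurable_mx_norm.
have mB3 : measurable B3.
  apply: measurable_superlevel; apply: measurable_mx_norm.
  by apply: random_matrixZ => //; apply: random_matrixB => //; exact: thetatilde_meas.
have mB4 : measurable B4.
  apply: measurable_superlevel.
  apply: (measurableT_comp (@normr_measurable R setT)).
  apply: measurable_funM => //; apply: measurable_bigmaxr => j.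
  exact: kappa_meas.
have mB5 : measurable B5.
  apply: measurable_superlevel; apply: measurable_mx_norm.
  by apply: random_matrixB => //; exact: Ghat_meas.
have B_e : (P (B1 `|` (B2 `|` (B3 `|` (B4 `|` B5)))) <= e%:E)%E.
  have -> : e = e5 + (e5 + (e5 + (e5 + e5))) by rewrite /e5; lra.
  have mB45 := measurableU _ _ mB4 mB5; have mB345 := measurableU _ _ mB3 mB45.
  have mB2345 := measurableU _ _ mB2 mB345.
  apply: measureU_le => //; apply: measureU_le => //.
  by apply: measureU_le => //; apply: measureU_le.
apply: le_trans B_e; apply: le_measure_ae => //.
  by repeat apply: measurableU.
apply: filterS2 (thetahat_min T TTT) G_posdef => w w_min w_pos.
(* By contraposition: outside the five bad events every hypothesis of [bound] holds, minimality
   being used at [thetastar]. *)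
apply: contraPP => /not_orP[/negP]; rewrite -leNgt => wK.
move=> /not_orP[/negP]; rewrite -leNgt => wL.
move=> /not_orP[/negP]; rewrite -leNgt => wM.
move=> /not_orP[/negP]; rewrite -leNgt => wM'.
move=> /negP; rewrite -leNgt => wD.
apply/negP; rewrite -leNgt.
rewrite normrZ gtr0_norm ?invr_gt0// ler_pdivrMl// mulrC.
apply: (bound (r T) (G w) (Ghat T w) (thetatilde T w) _ (fun j => kappa T j w)) => //.
- by move=> j; exact: kappa_ge0.
- by rewrite /invmx (sym_posdef_unitmx _ w_pos).
- apply: le_trans (ler_wpM2l _ wD) _; first by rewrite mulr_ge0 ?ltW.
  by rewrite /delta invfM mulrCA divff ?mulr1// gt_eqF// mulr_gt0.
- by rewrite -(subrK (G w) (Ghat T w)) (le_trans (ler_normD _ _))// addrC lerD.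
- by move: wM; rewrite normrZ gtr0_norm ?invr_gt0// ler_pdivrMl// mulrC.
- move: wM'; rewrite normrM (gtr0_norm (_ : 0 < (r T)^-1)) ?invr_gt0// ler_pdivrMl// mulrC.
  exact: le_trans (ler_norm _).
Unshelve. all: by end_near.
Qed.
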